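(* Let $E$ be a separable Hilbert space. For $\xi\in H^\infty(\mathbb{D},E)$, $$\mathrm{POC}(\{\xi\},H^2(\mathbb{D},E))\subset H^2(\mathbb{D},E)\ominus\mathrm{PLS}(\{\xi\},H^2(\mathbb{D},E)).$$
   Context: $\mathbb{D}$ is the open unit disc and $\mathbb{T}$ the unit circle. Hilbert spaces are complex. $H^\infty(\mathbb{D},E)$ is the space of bounded analytic $E$-valued functions on $\mathbb{D}$. $H^2(\mathbb{D},E)$ is the space of analytic $f:\mathbb{D}\to E$ with $\|f\|_2=\sup_{0<r<1}\left(\frac1{2\pi}\int_0^{2\pi}\|f(re^{i\theta})\|_E^2\,d\theta\right)^{1/2}<\infty$. Functions in these spaces have radial limits in the norm of $E$ almost everywhere on $\mathbb{T}$, denoted by the same letter; via radial limits, $H^2(\mathbb{D},E)$ is identified isometrically with a closed subspace of $L^2(\mathbb{T},E)$, whose norm is $\left(\frac1{2\pi}\int_0^{2\pi}\|f(e^{i\theta})\|_E^2\,d\theta\right)^{1/2}$. For a subspace $F$ of $L^2(\mathbb{T},E)$ and a subset $X$ of $L^2(\mathbb{T},E)$: the pointwise orthogonal complement of $X$ in $F$ is $\mathrm{POC}(X,F)=\{f\in F:f(z)\perp\{x(z):x\in X\}\text{ for almost all }z\in\mathbb{T}\}$; the pointwise linear span of $X$ in $F$ is $\mathrm{PLS}(X,F)=\{f\in F: f(z)\in\mathrm{span}\{x(z):x\in X\}\text{ for almost all }z\in\mathbb{T}\}$. $H\ominus M$ denotes the set of vectors in the Hilbert space $H$ orthogonal (in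 the inner product of $H$) to $M$. *)

(* Defs.v *)
From HB Require Import structures.
From mathcomp Require Import all_boot all_order all_algebra.
From mathcomp Require Import complex.
From mathcomp Require Import all_classical all_reals all_analysis.

Set Implicit Arguments.
Unset Strict Implicit.
Unset Printing Implicit Defensive.

Import Order.TTheory GRing.Theory Num.Theory.
Import numFieldNormedType.Exports.

Local Open Scope classical_set_scope.
Local Open Scope ring_scope.
Local Open Scope complex_scope.

(* A complex Hilbert space is a Banach space E over R[i] (R : realType) together
   with a positive definite Hermitian form ip, linear in its first argument,
   such that `|x| ^+ 2 = ip x x. *)

Definition separable (T : topologicalType) : Prop :=
  exists2 S : set T, countable S & dense S.

Definition lin_span (K : pzRingType) (V : lmodType K) (S : set V) : set V :=
  [set v | exists n (a : 'I_n -> K) (s : 'I_n -> V),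
     (forall i, S (s i)) /\ v = \sum_(i < n) a i *: s i].

(* Functions on the disc or on the circle are total functions R[i] -> E of which
   only the values on the disc, respectively on the circle, are ever used. *)
Section Circle.
Variable R : realType.

Definition expi (t : R) : R[i] := cos t +i* sin t.

Definition angles : set R := `[0, 2 * pi].

Definition ae_circle (P : R[i] -> Prop) : Prop :=
  {ae (@lebesgue_measure R), forall t, angles t -> P (expi t)}.

End Circle.

Section VectorValued.
Variables (R : realType) (E : completeNormedModType R[i]).
Implicit Types f g : R[i] -> E.

(* The norm of E takes its values in the nonnegative reals of R[i]. *)
Definition hnorm (x : E) : R := complex.Re `|x|.

Definition circle_measurable f : Prop :=
  forall O : set E, open O -> measurable (angles (R:=R) `&` (f \o @expi R) @^-1` O).

Definition L2norm f : \bar R :=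
  (((2 * pi)^-1%:E *
    \int[@lebesgue_measure R]_(t in angles (R:=R)) (hnorm (f (expi t)) ^+ 2)%:E)
     `^ 2^-1)%E.

(* Elements of L^2(T,E) are represented by functions; equality in L^2(T,E) is
   equality almost everywhere. Since E is only used when separable, Borel
   measurability is the same as strong measurability. *)
Definition L2 : set (R[i] -> E) :=
  [set f | circle_measurable f /\ (L2norm f < +oo)%E].

Definition analytic_disc f : Prop :=
  forall z : R[i], `|z| < 1 -> derivable (f : R[i]^o -> E) z 1.

Definition Hinfty : set (R[i] -> E) :=
  [set f | analytic_disc f /\
           exists M : R, forall z : R[i], `|z| < 1 -> hnorm (f z) <= M].

Definition H2norm f : \bar R :=
  ereal_sup [set L2norm (fun z => f (r%:C * z)) | r in `]0, 1[%classic].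

Definition H2disc : set (R[i] -> E) :=
  [set f | analytic_disc f /\ (H2norm f < +oo)%E].

Definition radial_limit f : R[i] -> E :=
  fun z => lim (f (r%:C * z) @[r --> (1 : R)^'-]).

(* H^2(D,E) as a subspace of L^2(T,E), via radial limits. *)
Definition H2 : set (R[i] -> E) :=
  [set g | L2 g /\
           exists2 f, H2disc f & ae_circle (fun z => g z = radial_limit f z)].

Definition PLS (X F : set (R[i] -> E)) : set (R[i] -> E) :=
  [set f | F f /\
     ae_circle (fun z => lin_span [set x z | x in X] (f z))].

Variable ip : E -> E -> R[i].

Definition POC (X F : set (R[i] -> E)) : set (R[i] -> E) :=
  [set f | F f /\
     ae_circle (fun z => forall v, [set x z | x in X] v -> ip (f z) v = 0)].

Definition L2ip f g : R[i] :=
  let I (u : R[i] -> R) :=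
    (2 * pi)^-1 *
    (\int[@lebesgue_measure R]_(t in angles (R:=R)) u (ip (f (expi t)) (g (expi t)))) in
  I (@complex.Re R) +i* I (@complex.Im R).

Definition ominus (H M : set (R[i] -> E)) : set (R[i] -> E) :=
  [set h | H h /\ forall m, M m -> L2ip h m = 0].

End VectorValued.

Arguments H2 {R} E.

(* Main.v *)
Require Import Defs.
From mathcomp Require Import all_boot all_order all_algebra.
From mathcomp Require Import complex.
From mathcomp Require Import all_classical all_reals all_analysis.
From mathcomp Require Import measurable_realfun.

(** At almost every point [z] of the circle, a function [m] in the pointwise
    span of the boundary values of [xi] has a value proportional to [xi z],
    while a function [h] in their pointwise orthogonal complement has [h z]
    orthogonal to [xi z]. By conjugate linearity ([ip_lin_span0]) the integrand
    [ip (h z) (m z)] of the inner product of [L^2(T,E)] vanishes almost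
    everywhere, hence so does that inner product ([ae0_L2ip]).

    The last step rests on [ae0_integral0], which concerns arbitrary functions:
    the integral of a nonnegative function is the supremum of the integrals of
    the simple functions below it, and if the function vanishes almost
    everywhere then so do these simple functions. *)

Import Order.TTheory GRing.Theory Num.Theory.
Import HBNNSimple.

Local Open Scope classical_set_scope.
Local Open Scope ring_scope.
Local Open Scope complex_scope.

Section AeZeroIntegral.
Context d (T : measurableType d) (R : realType).
Variable mu : {measure set T -> \bar R}.
Local Open Scope ereal_scope.

(** Almost everywhere equality is applied only to the simple functions below
    [f], which are measurable; [f] itself may fail to be. *)
Lemma ge0_ae0_integral0 (D : set T) (f : T -> \bar R) :
  (forall x, D x -> 0 <= f x) -> {ae mu, forall x, D x -> f x = 0} ->
  \int[mu]_(x in D) f x = 0.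
Proof.
move=> f0 aef.
apply/eqP; rewrite eq_le integral_ge0 // andbT ge0_integralE //.
apply/ge_ereal_sup => _ [h /= hf <-].
rewrite -integralT_nnsfun (ae_eq_integral (cst 0)) ?integral0 //.
- exact/measurable_EFinP.
- apply: filterS aef => x fx _ /=.
  apply/eqP; rewrite eq_le andbC lee_fin fun_ge0 /=.
  apply: le_trans (hf x) _; rewrite patchE.
  by case: ifPn => [|//]; rewrite inE => /fx ->.
Qed.

Lemma ae0_integral0 (D : set T) (f : T -> \bar R) :
  {ae mu, forall x, D x -> f x = 0} -> \int[mu]_(x in D) f x = 0.
Proof.
move=> aef; rewrite integralE.
by rewrite !ge0_ae0_integral0 ?sube0 //; apply: filterS aef => x fx /fx;
  rewrite ?funeposE ?funenegE => ->; rewrite ?oppe0 maxxx.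
Qed.

End AeZeroIntegral.

(** Instance resolution does not see through the generated sigma-algebra
    underlying [lebesgue_measure]. *)
Local Instance ae_lebesgue_filter (R : realType) :
  Filter (almost_everywhere (@lebesgue_measure R)).
Proof. exact: (ae_filter_ringOfSetsType (@lebesgue_measure R)). Qed.

Lemma ae0_L2ip (R : realType) (E : completeNormedModType R[i])
    (ip : E -> E -> R[i]) (f g : R[i] -> E) :
  ae_circle (fun z => ip (f z) (g z) = 0) -> L2ip ip f g = 0.
Proof.
rewrite /ae_circle => fg0; rewrite /L2ip /Rintegral.
by rewrite !ae0_integral0 ?mulr0 //; apply: filterS fg0 => t ip0 /ip0 ->.
Qed.

Lemma ip_lin_span0 (K : numClosedFieldType) (V : lmodType K)
    (ip : {dot V for Num.conj}) (u : V) (S : set V) :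
  (forall v, S v -> ip u v = 0) -> forall v, lin_span S v -> ip u v = 0.
Proof.
move=> uS _ [n [a [s [Ss ->]]]].
by rewrite linear_sumr big1 // => i _; rewrite linearZr_LR /= uS ?mulr0.
Qed.

Theorem lemma4p14 (R : realType) (E : completeNormedModType R[i])
    (ip : {dot E for Num.conj})
    (norm_ip : forall x : E, `|x| ^+ 2 = ip x x)
    (sepE : separable E)
    (xi : R[i] -> E) (Hxi : Hinfty xi) :
  POC ip [set radial_limit xi] (H2 E) `<=`
  ominus ip (H2 E) (PLS [set radial_limit xi] (H2 E)).
Proof.
move=> h [H2h h_perp]; split=> // m [_ m_span]; apply: ae0_L2ip.
move: h_perp m_span; rewrite /ae_circle; apply: filterS2 => t h_perp m_span Dt.
exact: ip_lin_span0 (h_perp Dt) _ (m_span Dt).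
Qed.
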